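(* Every complete graph has the strong polynomial Rödl property; that is, for every complete graph $H$ there exists a constant $C_H>0$ such that for every $0<\varepsilon\le 1/2$, every $H$-free graph $G$ admits a partition of $V(G)$ into at most $(1/\varepsilon)^{C_H}$ sets, each of which is strongly $\varepsilon$-restricted.
   Context: All graphs are finite and simple. A graph $G$ is $H$-free if it contains no induced subgraph isomorphic to $H$. For $\varepsilon>0$, a set $S\subseteq V(G)$ is strongly $\varepsilon$-restricted if one of $G[S]$ and $\overline{G}[S]$ (the induced subgraph of $G$ or of its complement on $S$) has maximum degree at most $\varepsilon|S|$. *)

(* Defs.v *)
From HB Require Import structures.
From mathcomp Require Import all_boot all_order all_algebra.
From mathcomp Require Import reals exp.

Set Implicit Arguments.
Unset Strict Implicit.
Unset Printing Implicit Defensive.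

Import Order.TTheory GRing.Theory Num.Theory.

Local Open Scope ring_scope.

Record sgraph := SGraph {
  vertex :> finType;
  adj : rel vertex;
  adj_sym : symmetric adj;
  adj_irrefl : irreflexive adj
}.

Section Graphs.
Variable G : sgraph.

Definition compl_adj : rel G := [rel x y | (x != y) && ~~ adj x y].

Lemma compl_adj_sym : symmetric compl_adj.
Proof. by move=> x y; rewrite /compl_adj /= eq_sym adj_sym. Qed.

Lemma compl_adj_irrefl : irreflexive compl_adj.
Proof. by move=> x; rewrite /compl_adj /= eqxx. Qed.

Definition compl_graph : sgraph := SGraph compl_adj_sym compl_adj_irrefl.

Section Induced.
Variable S : {set G}.

Definition induced_adj : rel {x : G | x \in S} :=
  [rel x y | adj (val x) (val y)].

Lemma induced_adj_sym : symmetric induced_adj.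
Proof. by move=> x y; rewrite /induced_adj /= adj_sym. Qed.

Lemma induced_adj_irrefl : irreflexive induced_adj.
Proof. by move=> x; rewrite /induced_adj /= adj_irrefl. Qed.

Definition induced : sgraph := SGraph induced_adj_sym induced_adj_irrefl.

End Induced.

Definition degree (v : G) : nat := #|[set w : G | adj v w]|.

Definition max_degree : nat := (\max_(v : G) degree v)%N.

Definition complete_graph : Prop := forall x y : G, x != y -> adj x y.

End Graphs.

Definition graph_iso (G H : sgraph) : Prop :=
  exists2 f : G -> H, bijective f & forall x y : G, adj (f x) (f y) = adj x y.

Definition graph_free (H G : sgraph) : Prop :=
  ~ exists S : {set G}, graph_iso (induced S) H.

Definition strongly_restricted (R : realType) (eps : R) (G : sgraph)
    (S : {set G}) : Prop :=
  (max_degree (induced S))%:R <= eps * #|S|%:R \/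
  (max_degree (@induced (compl_graph G) S))%:R <= eps * #|S|%:R.

(* [partition] requires nonempty blocks; as only an upper bound is put on the
   number of blocks, allowing empty ones would make no difference. *)
Definition strong_polynomial_Rodl (R : realType) (H : sgraph) : Prop :=
  exists2 C : R, 0 < C &
    forall eps : R, 0 < eps -> eps <= 1 / 2 ->
    forall G : sgraph, graph_free H G ->
    exists P : {set {set G}},
      [/\ partition P [set: G],
          #|P|%:R <= (1 / eps) `^ C
        & forall S : {set G}, S \in P -> strongly_restricted eps S].

(* Main.v *)
Require Import Defs.
From mathcomp Require Import all_boot all_order all_algebra.
From mathcomp Require Import reals exp.
From mathcomp Require Import zify lra.

(** Let [t] be the order of the excluded complete graph, and call a set sparse
    if its maximum degree is a small fraction of its size.  Passing repeatedly
    to a neighbourhood, every set contains a sparse subset that is a polynomial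
    fraction of it; removing such subsets greedily, polynomially many sparse
    sets cover all but an exponentially small remainder [R].  A vertex of [R]
    can be added to a much larger sparse set [P] unless it has many neighbours
    in [P].  We maintain sparse sets [P_1, ..., P_s], all much larger than the
    current remainder, such that any dense subsets of them span a positive
    density of transversal [s]-cliques.  The vertices of [R] that cannot be
    added to any [P_i] then span with the [P_i] many transversal
    [s+1]-cliques, and a density-increment argument produces [s+1] such sets
    and an exponentially smaller remainder.  After [t] rounds a [t]-clique
    appears, so the remainder must have been exhausted before. *)

Set Implicit Arguments.
Unset Strict Implicit.
Unset Printing Implicit Defensive.

Import Order.TTheory GRing.Theory Num.Theory.

(** * Elementary inequalities on powers *)

Section Arithmetic.
Implicit Types (a b m n E V C x v : nat).

(** A single term of the binomial expansion of the right side. *)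
Lemma expn_add_ge a b n : n * a ^ n.-1 * b <= (a + b) ^ n.
Proof.
case: n => [|n] //=; elim: n => [|n IHn]; first by rewrite !expn1 expn0 !mul1n leq_addl.
have h : a ^ n.+1 * b <= (a + b) ^ n.+1 * b by rewrite leq_mul2r leq_exp2r ?leq_addr ?orbT.
have -> : n.+2 * a ^ n.+1 * b = a * (n.+1 * a ^ n * b) + a ^ n.+1 * b.
  by rewrite (expnS a n); lia.
rewrite (expnS (a + b)) mulnDl leq_add //; first by rewrite leq_mul2l IHn orbT.
by rewrite [X in _ <= X]mulnC.
Qed.

(* AM-GM for [C - 1] copies of [v / V] and one copy of [1], applied to the [C]-th root. *)
Lemma amgm_pow C x v E V : 0 < C -> 0 < V ->
  x ^ C * V ^ C.-1 <= E ^ C * v ^ C.-1 -> C * x * V <= E * (C * v + V).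
Proof.
move=> C0 V0; apply: contraTT; rewrite -!ltnNge => h.
have := h; rewrite -(ltn_exp2r _ _ C0) !expnMn => {}h.
have h2 := expn_add_ge (C * v) V C.
have {h2}h3 : E ^ C * (C * (C * v) ^ C.-1 * V) < C ^ C * x ^ C * V ^ C.
  by apply: leq_ltn_trans h; rewrite leq_mul2l h2 orbT.
case: C C0 h h3 => // C _ h /=; rewrite expnMn.
have -> : E ^ C.+1 * (C.+1 * (C.+1 ^ C * v ^ C) * V) =
  (C.+1 ^ C.+1 * V) * (E ^ C.+1 * v ^ C) by rewrite (expnS C.+1); lia.
have -> : C.+1 ^ C.+1 * x ^ C.+1 * V ^ C.+1 =
  (C.+1 ^ C.+1 * V) * (x ^ C.+1 * V ^ C) by rewrite (expnS V); lia.
by rewrite ltn_pmul2l // muln_gt0 expn_gt0 V0.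
Qed.

(** This is [(1 - 1/m)^m <= 1/2]; Bernoulli's inequality gives [(1 + 1/(m-1))^m >= 2]. *)
Lemma two_expn_pred m : 0 < m -> 2 * m.-1 ^ m <= m ^ m.
Proof.
case: m => // m _ /=.
have h : forall n, m ^ n * (m + n) <= m.+1 ^ n * m.
  elim=> [|n IHn]; first by rewrite addn0.
  rewrite !expnS; move: IHn; set x := m ^ n; set y := m.+1 ^ n; nia.
case: (posnP m) => [->|m0] //.
rewrite -(leq_pmul2r m0); apply: leq_trans (h m.+1).
by rewrite -mulnA mulnCA leq_mul2l; lia.
Qed.

End Arithmetic.

(** * Boxes of vertex sets and their transversal cliques *)

Section Boxes.
Variable G : sgraph.
Implicit Types (A B K S : {set G}) (P Y Z : seq {set G}).

Definition nbrs (v : G) : {set G} := [set w | adj v w].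

Definition clique K := {in K &, forall x y, x != y -> adj x y}.

Definition vol P := \prod_(A <- P) #|A|.

(* The number of tuples [x_1, ..., x_s] of pairwise adjacent vertices with
   [x_i] in the [i]-th set; [s] is fuel, since the recursive call is made on
   a mapped list. *)
Fixpoint ncliques_rec (s : nat) P : nat :=
  match s, P with
  | s'.+1, A :: P' => \sum_(r in A) ncliques_rec s' [seq nbrs r :&: B | B <- P']
  | _, _ => 1
  end.

Definition ncliques P := ncliques_rec (size P) P.

Definition sub_box Y P := all2 (fun B A : {set G} => B \subset A) Y P.

Definition dense_box q Y P := all2 (fun B A : {set G} => #|A| <= q * #|B|) Y P.

Lemma ncliques_cons A P :
  ncliques (A :: P) = \sum_(r in A) ncliques [seq nbrs r :&: B | B <- P].
Proof. by rewrite /ncliques /=; apply: eq_bigr => r _; rewrite size_map. Qed.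

Lemma vol_cons A P : vol (A :: P) = #|A| * vol P.
Proof. by rewrite /vol big_cons. Qed.

Lemma vol_cat P Y : vol (P ++ Y) = vol P * vol Y.
Proof. by rewrite /vol big_cat. Qed.

Lemma sub_box_refl P : sub_box P P.
Proof. by elim: P => //= A P ->; rewrite subxx. Qed.

Lemma sub_box_trans Y P Z : sub_box Y P -> sub_box P Z -> sub_box Y Z.
Proof.
elim: Y P Z => [|B Y IH] [|A P] [|D Z] //= /andP[BA YP] /andP[AD PZ].
by rewrite (subset_trans BA AD) (IH _ _ YP PZ).
Qed.

Lemma sub_box_cat Y1 P1 Y2 P2 :
  sub_box Y1 P1 -> sub_box Y2 P2 -> sub_box (Y1 ++ Y2) (P1 ++ P2).
Proof. by elim: Y1 P1 => [|B Y IH] [|A P] //= /andP[-> YP] Y2P2; rewrite IH. Qed.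

Lemma sub_box_size Y P : sub_box Y P -> size Y = size P.
Proof. by elim: Y P => [|B Y IH] [|A P] //= /andP[_ /IH->]. Qed.

Lemma sub_box_setI v P : sub_box [seq nbrs v :&: B | B <- P] P.
Proof. by elim: P => //= A P ->; rewrite subsetIr. Qed.

Lemma leq_vol Y P : sub_box Y P -> vol Y <= vol P.
Proof.
elim: Y P => [|B Y IH] [|A P] //= /andP[BA YP].
by rewrite !vol_cons leq_mul ?IH ?subset_leq_card.
Qed.

Lemma ncliques_le_vol P : ncliques P <= vol P.
Proof.
have [s] := ubnP (size P); elim: s P => // s IHs [|A P] /=; first by rewrite /vol big_nil.
rewrite ltnS => sP; rewrite ncliques_cons vol_cons -sum_nat_const leq_sum // => r _.
by apply: leq_trans (leq_vol (sub_box_setI r P)); apply: IHs; rewrite size_map.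
Qed.

(** Additivity in each coordinate turns an upper bound for the discarded part of a side into a lower
    bound for the kept part. *)
Lemma ncliques_setU P1 A B P2 : [disjoint A & B] ->
  ncliques (P1 ++ (A :|: B) :: P2) =
  ncliques (P1 ++ A :: P2) + ncliques (P1 ++ B :: P2).
Proof.
have [s] := ubnP (size P1); elim: s P1 A B P2 => // s IHs [|D P1] A B P2 /= sP dAB.
  by rewrite !ncliques_cons -bigU //; apply: eq_bigl => x; rewrite !inE.
rewrite !ncliques_cons -big_split; apply: eq_bigr => r _ /=.
rewrite !map_cat /= setIUr IHs ?size_map //.
by rewrite -setI_eq0 setIACA setIid (disjoint_setI0 dAB) setI0.
Qed.

Lemma vol_setU P1 A B P2 : [disjoint A & B] ->
  vol (P1 ++ (A :|: B) :: P2) = vol (P1 ++ A :: P2) + vol (P1 ++ B :: P2).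
Proof.
move=> dAB; rewrite !vol_cat !vol_cons cardsU (disjoint_setI0 dAB) cards0 subn0.
by rewrite mulnDl mulnDr.
Qed.

Lemma clique_setU1 v K : clique K -> K \subset nbrs v -> clique (v |: K).
Proof.
move=> cK /subsetP Kv; have Kadj x : x \in K -> adj v x by move/Kv; rewrite inE.
move=> x y; rewrite !inE => /orP[/eqP->|xK] /orP[/eqP->|yK]; rewrite ?eqxx // => xy.
- exact: Kadj.
- by rewrite adj_sym Kadj.
- exact: cK.
Qed.

Lemma ncliques_gt0_clique P : 0 < ncliques P ->
  exists K, [/\ clique K, #|K| = size P & {subset K <= \bigcup_(A <- P) A}].
Proof.
have [s] := ubnP (size P); elim: s P => // s IHs [|A P] /= sP.
  by exists set0; split=> [x y|  |x]; rewrite ?cards0 ?inE.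
rewrite ncliques_cons lt0n sum_nat_eq0 negb_forall => /existsP[r].
rewrite negb_imply -lt0n => /andP[rA] /IHs[|K [cK sK KP]]; first by rewrite size_map.
have Kr x : x \in K -> x \in nbrs r :&: \bigcup_(A <- P) A.
  by move/KP; rewrite big_map -big_distrr.
have Kadj : K \subset nbrs r by apply/subsetP => x /Kr; rewrite inE => /andP[].
exists (r |: K); split=> [| |x]; first exact: clique_setU1.
- rewrite cardsU1 sK size_map; case: (boolP (r \in K)) => // /(subsetP Kadj).
  by rewrite inE adj_irrefl.
- rewrite big_cons !inE => /orP[/eqP->|/Kr]; first by rewrite rA.
  by rewrite inE => /andP[_ ->]; rewrite orbT.
Qed.

End Boxes.

(** * Density increment for transversal cliques *)

Section Komlos.
Variable G : sgraph.
Implicit Types (A B K S : {set G}) (P Y Z : seq {set G}).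

Lemma potential_maximiser C P : 0 < C -> 0 < ncliques P ->
  exists Z, [/\ sub_box Z P, 0 < ncliques Z &
    forall Y, sub_box Y P ->
      ncliques Y ^ C * vol Z ^ C.-1 <= ncliques Z ^ C * vol Y ^ C.-1].
Proof.
move=> C0 e0.
(* A box of zero volume spans no clique, so its potential is 0; the potential of [P] is positive,
   which forces cliques in the maximiser. *)
pose F (Y : (size P).-tuple {set G}) : rat :=
  ((ncliques Y)%:R ^+ C / (vol Y)%:R ^+ C.-1)%R.
pose sub (Y : (size P).-tuple {set G}) := sub_box Y P.
have [Z ZP Zmax] := arg_maxP F (sub_box_refl P : sub (in_tuple P)).
have v0 (Y : seq {set G}) : 0 < ncliques Y -> 0 < vol Y.
  by move=> Y0; apply: leq_trans (ncliques_le_vol Y).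
have FP : (0 < F (in_tuple P))%R.
  by rewrite divr_gt0 ?exprn_gt0 // ltr0n // v0.
have Z0 : 0 < ncliques Z.
  have /(lt_le_trans FP) := Zmax (in_tuple P) (sub_box_refl P).
  by rewrite /F lt0n; case: (ncliques Z) => //; rewrite expr0n eqn0Ngt C0 mul0r ltxx.
exists Z; split=> // Y YP.
have [Y0|Y0] := posnP (ncliques Y); first by rewrite Y0 exp0n.
have sY : size Y == size P by rewrite (sub_box_size YP).
have := Zmax (Tuple sY) YP; rewrite /F /=.
rewrite ler_pdivrMr ?exprn_gt0 ?ltr0n ?v0 // mulrAC.
by rewrite ler_pdivlMr ?exprn_gt0 ?ltr0n ?v0 // -!natrX -!natrM ler_nat.
Qed.

(* Telescoping from [P] to [Y] one coordinate at a time. *)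
Lemma ncliques_hybrid E V C k Y1 Y2 P2 :
  (forall Z, sub_box Z (Y1 ++ P2) ->
     C * ncliques Z * V <= E * (C * vol Z + V)) ->
  E * C * vol (Y1 ++ P2) <= C * ncliques (Y1 ++ P2) * V + E * k * V ->
  sub_box Y2 P2 ->
  E * C * vol (Y1 ++ Y2) <= C * ncliques (Y1 ++ Y2) * V + E * (k + size P2) * V.
Proof.
elim: P2 k Y1 Y2 => [|A P2 IH] k Y1 [|B Y2] //= Hmax H; first by rewrite addn0.
move=> /andP[BA YP2].
have sub (D : {set G}) : D \subset A -> sub_box (Y1 ++ D :: P2) (Y1 ++ A :: P2).
  by move=> DA; apply: sub_box_cat; rewrite /sub_box /= ?DA; apply: sub_box_refl.
have AE : A = B :|: (A :\: B) by rewrite -{1}(setID A B) (setIidPr BA).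
have dAB : [disjoint B & A :\: B] by rewrite -setI_eq0 setIDA setDIl setDv set0I.
have eC : ncliques (Y1 ++ A :: P2) =
    ncliques (Y1 ++ B :: P2) + ncliques (Y1 ++ (A :\: B) :: P2).
  by rewrite {1}AE ncliques_setU.
have eV : vol (Y1 ++ A :: P2) = vol (Y1 ++ B :: P2) + vol (Y1 ++ (A :\: B) :: P2).
  by rewrite {1}AE vol_setU.
(* Maximality limits what is lost with [A :\: B]; each coordinate costs one error term [E * V]. *)
have HD := Hmax _ (sub _ (subsetDl A B)).
rewrite -cat_rcons -addSnnS; apply: IH => // [Z|].
  by rewrite cat_rcons => /sub_box_trans/(_ (sub _ BA))/Hmax.
rewrite cat_rcons; move: H HD; rewrite eC eV.
move: (ncliques _) (ncliques _) (vol _) (vol _) => c1 c2 v1 v2.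
by nia.
Qed.

Lemma dense_box_vol q Y P : dense_box q Y P -> vol P <= q ^ size P * vol Y.
Proof.
elim: Y P => [|B Y IH] [|A P] //=; first by rewrite mul1n.
move=> /andP[AB /IH h]; rewrite !vol_cons expnS mulnACA; exact: leq_mul.
Qed.

(** The other sides only shrink, so no single side can lose more than the total factor [q]. *)
Lemma vol_dense_box q Y P : sub_box Y P -> 0 < vol P -> vol P <= q * vol Y ->
  dense_box q Y P.
Proof.
elim: Y P => [|B Y IH] [|A P] //= /andP[BA YP].
rewrite !vol_cons muln_gt0 => /andP[A0 P0] h; apply/andP; split.
  rewrite -(leq_pmul2r P0); apply: leq_trans h _.
  by rewrite mulnA leq_mul2l leq_vol ?orbT.
apply: IH => //; rewrite -(leq_pmul2l A0); apply: leq_trans h _.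
by rewrite mulnCA leq_mul2r subset_leq_card ?orbT.
Qed.

(* The box maximising [ncliques ^ C / vol ^ (C - 1)]: no sub-box can then carry
   much more than its share of the cliques, hence none can carry much less. *)
Lemma komlos D q P (s := size P) : 0 < s -> 0 < q -> 0 < vol P ->
  vol P <= D * ncliques P ->
  exists Z, [/\ sub_box Z P, 0 < vol Z, dense_box (D ^ (2 * s * q ^ s)) Z P &
    forall Y, sub_box Y Z -> dense_box q Y Z ->
      vol Z <= 2 * q ^ s * D * ncliques Y].
Proof.
(* With this [C] the [s] error terms of [ncliques_hybrid] are at most half the main term, as
   [vol Z <= q ^ s * vol Y]. *)
move=> s0 q0 V0 VD; set C := 2 * s * q ^ s.
have C0 : 0 < C by rewrite !muln_gt0 s0 expn_gt0 q0.
have e0 : 0 < ncliques P by case: (ncliques P) VD V0 => //; rewrite muln0; case: (vol P).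
have D0 : 0 < D by case: D VD => //; rewrite mul0n leqNgt V0.
have [Z [ZP E0 Zmax]] := potential_maximiser C0 e0.
have Z0 : 0 < vol Z by apply: leq_trans (ncliques_le_vol Z).
have VZP := leq_vol ZP.
(* Maximality against [P] itself; it yields both the clique density of [Z] and the bound on how far
   [Z] shrinks. *)
have DE : vol P * vol Z ^ C.-1 <= (D * ncliques Z) ^ C.
  have := Zmax P (sub_box_refl P).
  have : vol P ^ C <= (D * ncliques P) ^ C by rewrite leq_exp2r.
  have : 0 < vol P ^ C.-1 by rewrite expn_gt0 V0.
  rewrite -{2}(prednK C0) expnS !expnMn => p0 h1 h2.
  rewrite -(leq_pmul2r p0).
  apply: (@leq_trans (D ^ C * ncliques P ^ C * vol Z ^ C.-1)).
    by rewrite mulnAC leq_mul2r h1 orbT.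
  by rewrite -!mulnA leq_mul2l h2 orbT.
have VDE : vol Z <= D * ncliques Z.
  rewrite -(leq_exp2r _ _ C0); apply: leq_trans DE.
  by rewrite -{1}(prednK C0) expnS leq_mul2r VZP orbT.
exists Z; split=> //.
  apply: vol_dense_box => //.
  have p0 : 0 < vol Z ^ C.-1 by rewrite expn_gt0 Z0.
  rewrite -(leq_pmul2r p0); apply: leq_trans DE _.
  rewrite -mulnA -expnS prednK // -expnMn leq_exp2r // leq_mul2l.
  by rewrite ncliques_le_vol orbT.
move=> Y YZ YqZ.
have Zmax' W : sub_box W ([::] ++ Z) ->
    C * ncliques W * vol Z <= ncliques Z * (C * vol W + vol Z).
  move=> WZ; apply: amgm_pow => //; apply: Zmax; exact: sub_box_trans ZP.
have H0 : ncliques Z * C * vol ([::] ++ Z) <=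
    C * ncliques ([::] ++ Z) * vol Z + ncliques Z * 0 * vol Z.
  by rewrite /= muln0 mul0n addn0 [C * _]mulnC.
have := ncliques_hybrid Zmax' H0 YZ; rewrite /= add0n (sub_box_size ZP) -/s.
have := dense_box_vol YqZ; rewrite (sub_box_size ZP) -/s.
move: VDE; rewrite /C.
move: (ncliques Z) (ncliques Y) (vol Z) (vol Y) (q ^ s) Z0 => E e V v Q V0'.
move=> VDE VQ h.
suff : E <= 2 * Q * e by nia.
have h1 : E * (2 * s * Q) * v >= 2 * s * E * V by nia.
have h2 : s * E * V <= 2 * s * Q * e * V by nia.
by move: h2; rewrite leq_pmul2r // -!mulnA mulnCA leq_pmul2l.
Qed.

End Komlos.

(** * Sparse sets, sparse partitions and absorption *)

Section Partitions.
Variable G : sgraph.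
Implicit Types (A B K S R : {set G}) (P Y Z : seq {set G}).

Definition sparse n S := [forall (v | v \in S), n * #|nbrs v :&: S| <= #|S|].

Lemma sparseP n S :
  reflect (forall v, v \in S -> n * #|nbrs v :&: S| <= #|S|) (sparse n S).
Proof. exact: forall_inP. Qed.

Lemma sparse_leq m n S : m <= n -> sparse n S -> sparse m S.
Proof.
move=> mn /sparseP sS; apply/sparseP => v /sS; apply: leq_trans.
by rewrite leq_mul2r mn orbT.
Qed.

Definition sparse_partition n N A := exists Q : {set {set G}},
  [/\ partition Q A, #|Q| <= N & forall S, S \in Q -> sparse n S].

Lemma sparse_partition0 n : sparse_partition n 0 set0.
Proof.
exists set0; split=> [||S]; rewrite ?cards0 ?inE //.
by rewrite partition_set0.
Qed.

Lemma sparse_partition_leq n M N A :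
  M <= N -> sparse_partition n M A -> sparse_partition n N A.
Proof. by move=> MN [Q [? QM ?]]; exists Q; split=> //; apply: leq_trans MN. Qed.

Lemma sparse_partition1 n A : sparse n A -> sparse_partition n 1 A.
Proof.
move=> sA; have [->|A0] := eqVneq A set0.
  exact: sparse_partition_leq (sparse_partition0 n).
exists [set A]; split=> [||S]; rewrite ?cards1 //; last by rewrite inE => /eqP->.
apply/and3P; split; rewrite ?inE 1?eq_sym //; first by rewrite /cover big_set1.
by apply/trivIsetP => B D; rewrite !inE => /eqP-> /eqP->; rewrite eqxx.
Qed.

Lemma sparse_partitionU n M N A B : [disjoint A & B] ->
  sparse_partition n M A -> sparse_partition n N B ->
  sparse_partition n (M + N) (A :|: B).
Proof.
move=> dAB [Q1 [p1 c1 s1]] [Q2 [p2 c2 s2]]; exists (Q1 :|: Q2); split.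
- case/and3P: p1 => /eqP U1 T1 n1; case/and3P: p2 => /eqP U2 T2 n2.
  apply/and3P; split.
  + by rewrite /cover bigcup_setU -!/(cover _) U1 U2.
  + by apply: trivIsetU => //; rewrite U1 U2.
  + by rewrite inE negb_or n1.
- by rewrite cardsU; apply: leq_trans (leq_subr _ _) (leq_add c1 c2).
- by move=> S; rewrite inE => /orP[/s1|/s2].
Qed.

(** If [A] is not sparse, some [v] in [A] has more than [#|A| / p] neighbours in [A]. These span no
    [(t-1)]-clique, so each induction step costs a factor [p]. *)
Lemma clique_free_sparse_subset t p A : 0 < p ->
  (forall K, clique K -> K \subset A -> #|K| != t) ->
  exists S, [/\ S \subset A, sparse p S & #|A| <= p ^ t * #|S|].
Proof.
move=> p0; elim: t A => [|t IHt] A hA.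
  have c0 : clique (set0 : {set G}) by move=> x y; rewrite inE.
  by have := hA _ c0 (sub0set A); rewrite cards0.
have [sA|] := boolP (sparse p A).
  by exists A; split=> //; rewrite leq_pmull // expn_gt0 p0.
rewrite negb_forall => /existsP[v]; rewrite negb_imply -ltnNge => /andP[vA hv].
have [K cK KA|S [SA sS hS]] := IHt (nbrs v :&: A).
  have Kv : K \subset nbrs v by apply: subset_trans KA (subsetIl _ _).
  have := hA _ (clique_setU1 cK Kv); rewrite subUset sub1set vA.
  rewrite (subset_trans KA (subsetIr _ _)) => /(_ isT).
  rewrite cardsU1; case: (boolP (v \in K)) => [/(subsetP Kv)|//].
  by rewrite inE adj_irrefl.
exists S; split=> //; first exact: subset_trans SA (subsetIr _ _).
apply: leq_trans (ltnW hv) _; by rewrite expnS -mulnA leq_mul2l hS orbT.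
Qed.

Lemma exists_half A : exists B, [/\ B \subset A, #|A| <= 2 * #|B| & 2 * #|B| <= #|A|.+1].
Proof.
exists [set x in take (uphalf #|A|) (enum A)].
have -> : #|[set x in take (uphalf #|A|) (enum A)]| = uphalf #|A|.
  rewrite cardsE; have /card_uniqP-> := take_uniq (uphalf #|A|) (enum_uniq A).
  by rewrite size_take -cardE; case: ltnP => //; lia.
split; [|lia..].
by apply/subsetP => x; rewrite inE => /mem_take; rewrite mem_enum.
Qed.

Definition union P := \bigcup_(A <- P) A.

Lemma union_cons A P : union (A :: P) = A :|: union P.
Proof. by rewrite /union big_cons. Qed.

Fixpoint disjoint_box P :=
  if P is A :: P' then [disjoint A & union P'] && disjoint_box P' else true.

Lemma sub_box_union Y P : sub_box Y P -> union Y \subset union P.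
Proof.
elim: Y P => [|B Y IH] [|A P] //= /andP[BA /IH YP].
by rewrite !union_cons setUSS.
Qed.

Lemma sub_box_disjoint Y P : sub_box Y P -> disjoint_box P -> disjoint_box Y.
Proof.
elim: Y P => [|B Y IH] [|A P] //= /andP[BA YP] /andP[dA dP].
rewrite (IH P) // andbT (disjointWl BA) // (disjointWr _ dA) //.
exact: sub_box_union.
Qed.

Definition unabsorbed p P R :=
  [set r in R | all (fun A : {set G} => #|A| <= p * #|nbrs r :&: A|) P].

(** Each vertex of [R] outside [unabsorbed] joins the first [A] in [P] where it has few neighbours,
    while the reserved sets [S] are cut out. Degrees in the new part are at most
    [#|A| / p + #|R| <= 2 * #|A| / p], and at least [#|A| / 3] vertices survive; hence
    [p = 6 * n]. *)
Lemma absorb n P (S : seq {set G}) R (p := 6 * n) : disjoint_box (R :: P) -> sub_box S P ->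
  all2 (fun B A : {set G} => #|A| <= 3 * #|A :\: B|) S P -> all (sparse p) P ->
  all (fun A : {set G} => p * #|R| <= #|A|) P ->
  sparse_partition n (size P)
    ((R :|: union P) :\: (unabsorbed p P R :|: union S)).
Proof.
elim: P S R => [|A P IH] [|B S] R //.
  move=> _ _ _ _ _; rewrite /union /unabsorbed !big_nil !setU0 /=.
  rewrite (_ : _ :\: _ = set0); first exact: sparse_partition0.
  by apply/setP=> x; rewrite !inE andbT andNb.
move=> /= /and3P[dR dA dP] /andP[BA SP] /andP[AB hSP] /andP[sA sP] /andP[RA RP].
set R1 := [set r in R | #|A| <= p * #|nbrs r :&: A|].
have R1R : R1 \subset R by apply/subsetP => x; rewrite inE => /andP[].
have E : unabsorbed p (A :: P) R = unabsorbed p P R1.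
  by apply/setP => x; rewrite !inE /= andbA.
have dAx x : (x \in A) ==> (x \notin union P) by apply/implyP => xA; rewrite (disjointFr dA).
have dRx x : (x \in R) ==> (x \notin A :|: union P).
  by apply/implyP => xA; rewrite -union_cons (disjointFr dR).
have SPx x : (x \in union S) ==> (x \in union P) by apply/implyP/subsetP/sub_box_union.
have BAx x : (x \in B) ==> (x \in A) by apply/implyP/subsetP.
set X := (A :\: B) :|: (R :\: R1).
have -> : (R :|: union (A :: P)) :\: (unabsorbed p (A :: P) R :|: union (B :: S)) =
   X :|: ((R1 :|: union P) :\: (unabsorbed p P R1 :|: union S)).
  apply/setP => x; rewrite E !union_cons !inE.
  move: (dAx x) (dRx x) (SPx x) (BAx x).
  rewrite !inE.
  by case: (x \in R); case: (x \in A); case: (x \in union P); case: (x \in union S);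
  case: (x \in B); case: (#|A| <= _); case: (all _ _).
rewrite -add1n; apply: sparse_partitionU.
- rewrite disjoint_subset; apply/subsetP => x; rewrite !inE.
  move: (dAx x) (dRx x) (SPx x) (BAx x); rewrite !inE.
  by case: (x \in R); case: (x \in A); case: (x \in union P); case: (x \in union S);
  case: (x \in B); case: (#|A| <= _); case: (all _ _).
- apply: sparse_partition1; apply/sparseP => v vX.
  have hv : p * #|nbrs v :&: A| <= #|A|.
    move: vX; rewrite !inE => /orP[/andP[_ vA]|/andP[nv vR]].
      by move/sparseP: sA; apply.
    by move: nv; rewrite vR /= -ltnNge => /ltnW.
  have h1 : #|nbrs v :&: X| <= #|nbrs v :&: A| + #|R|.
    apply: leq_trans (leq_card_setU _ _) ; apply: subset_leq_card.
    apply/subsetP => x; rewrite !inE => /andP[-> /orP[/andP[_ ->]|/andP[_ ->]]] //=.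
    by rewrite orbT.
  have h2 : #|A :\: B| <= #|X| by apply/subset_leq_card/subsetUl.
  by rewrite /p in hv RA *; nia.
- apply: IH => //.
    by rewrite /= dP (disjointWl R1R) // (disjointWr _ dR) // union_cons subsetUr.
  apply: sub_all RP => D; apply: leq_trans; by rewrite leq_mul2l subset_leq_card ?orbT.
Qed.

End Partitions.

(** * Constants of the iteration *)

Section Constants.
Variables t n : nat.

Definition sparsity := 6 * n.
(** A factor 2 for halving a set and [sparsity ^ t] for making it sparse. *)
Definition shrink := 2 * sparsity ^ t.

(** Reciprocal of the clique density kept for [s] sets; each round brings the factor [2 * q ^ s] of
    [komlos], with [q = sparsity * shrink]. *)
Fixpoint inv_density s :=
  if s is s'.+1 then 2 * (sparsity * shrink) ^ s * inv_density s' else 1.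

Definition komlos_exponent s := 2 * s.+1 * (sparsity * shrink) ^ s.+1.

(** [shrink] extractions halve the remainder; the second factor counts the halvings needed to
    outweigh the shrinking in [komlos]. *)
Definition greedy_steps s :=
  shrink * (sparsity * shrink + inv_density s * komlos_exponent s).

(** With [u] rounds left and [s] sets: [s] parts from absorption, the greedy parts, then the next
    round. The case [u = 0] is contradictory, so its value is harmless. *)
Fixpoint nparts u s :=
  if u is u'.+1 then s + greedy_steps s + nparts u' s.+1 else 0.

End Constants.

(** * Greedy extraction and the iteration in a graph without [t]-cliques *)

Section CliqueFree.
Variables (G : sgraph) (t n : nat).
Hypothesis n_gt0 : 0 < n.
Hypothesis Gfree : forall K : {set G}, clique K -> #|K| != t.
Implicit Types (A B K S R : {set G}) (P Y Z : seq {set G}).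

Local Notation p := (sparsity n).
Local Notation Q := (shrink t n).

Lemma sparsity_gt0 : 0 < p.
Proof. by rewrite muln_gt0. Qed.

Lemma shrink_gt0 : 0 < Q.
Proof. by rewrite muln_gt0 expn_gt0 sparsity_gt0. Qed.

Lemma half_sparse_subset A :
  exists S, [/\ S \subset A, sparse p S, #|A| <= Q * #|S| & 2 * #|S| <= #|A|.+1].
Proof.
have [B [BA AB hB]] := exists_half A.
have [|S [SB sS hS]] := @clique_free_sparse_subset G t p B sparsity_gt0.
  by move=> K /Gfree.
exists S; split=> //; first exact: subset_trans BA.
  by apply: leq_trans AB _; rewrite -mulnA leq_mul2l.
apply: leq_trans hB; by rewrite leq_mul2l subset_leq_card.
Qed.

Lemma half_sparse_box P : exists Y, [/\ sub_box Y P, all (sparse p) Y,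
  dense_box Q Y P & all2 (fun B A : {set G} => 2 * #|B| <= #|A|.+1) Y P].
Proof.
elim: P => [|A P [Y [h1 h2 h3 h4]]]; first by exists [::].
have [S [g1 g2 g3 g4]] := half_sparse_subset A.
by exists (S :: Y); split; rewrite /= ?g1 ?g2 ?g3 ?g4.
Qed.

Lemma greedy_sparse k A : exists A', [/\ A' \subset A,
  sparse_partition n k (A :\: A') & Q ^ k * #|A'| <= Q.-1 ^ k * #|A|].
Proof.
elim: k => [|k [A' [AA pA hA]]].
  by exists A; split=> //; rewrite setDv; apply: sparse_partition0.
have [S [SA sS hS _]] := half_sparse_subset A'.
have dS := cardsID S A'; rewrite (setIidPr SA) in dS.
exists (A' :\: S); split.
- exact: subset_trans (subsetDl _ _) AA.
- have -> : A :\: (A' :\: S) = (A :\: A') :|: S.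
    apply/setP => x; rewrite !inE.
    have : (x \in S) ==> (x \in A') by apply/implyP/subsetP.
    have : (x \in A') ==> (x \in A) by apply/implyP/subsetP.
    by case: (x \in A); case: (x \in A'); case: (x \in S).
  rewrite -addn1; apply: sparse_partitionU => //.
    by rewrite -setI_eq0 setIDAC (setIidPr (subset_trans SA AA)) setD_eq0.
  by apply/sparse_partition1/(sparse_leq _ sS); rewrite /sparsity leq_pmull.
- have h : Q * #|A' :\: S| <= Q.-1 * #|A'|.
    by move: hS dS shrink_gt0; case: Q => // m /=; nia.
  move: (Q) h hA => q h hA; rewrite expnSr expnS -!mulnA.
  apply: (@leq_trans (q ^ k * (q.-1 * #|A'|))).
    by rewrite leq_mul2l h orbT.
  by rewrite mulnCA leq_mul2l hA orbT.
Qed.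

(** Each extraction removes a [1/Q] fraction, and [(1 - 1/Q)^Q <= 1/2], so [Q] extractions halve the
    remainder. *)
Lemma greedy_sparse_exp L A : exists A', [/\ A' \subset A,
  sparse_partition n (Q * L) (A :\: A') & 2 ^ L * #|A'| <= #|A|].
Proof.
have [A' [h1 h2 h3]] := greedy_sparse (Q * L) A; exists A'; split=> //.
move: (Q) shrink_gt0 h3 => q q0 h3.
have qL : 0 < q ^ (q * L) by rewrite expn_gt0 q0.
rewrite -(leq_pmul2l qL) mulnCA; apply: (@leq_trans (2 ^ L * (q.-1 ^ (q * L) * #|A|))).
  by rewrite leq_mul2l h3 orbT.
rewrite mulnA leq_mul2r !expnM -expnMn; apply/orP; right.
have [->|L0] := posnP L; first by rewrite !expn0.
by rewrite leq_exp2r // two_expn_pred.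
Qed.

Lemma dense_box_trans a b Y Z P :
  dense_box a Y Z -> dense_box b Z P -> dense_box (b * a) Y P.
Proof.
elim: Y Z P => [|B Y IH] [|D Z] [|A P] //= /andP[h1 h2] /andP[h3 h4].
rewrite (IH Z) // andbT; apply: leq_trans h3 _; by rewrite -mulnA leq_mul2l h1 orbT.
Qed.

Lemma dense_box_unabsorbed P R r : r \in unabsorbed p P R ->
  dense_box p [seq nbrs r :&: B | B <- P] P.
Proof. by rewrite inE => /andP[_]; elim: P => //= A P IH /andP[-> /IH]. Qed.

Lemma dense_box_refl P : dense_box p P P.
Proof. by elim: P => //= A P ->; rewrite leq_pmull // sparsity_gt0. Qed.

Lemma vol_dense_gt0 q Y P : dense_box q Y P -> 0 < vol P -> 0 < vol Y.
Proof.
move=> /dense_box_vol h1 h2; have := leq_trans h2 h1.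
by rewrite muln_gt0 => /andP[].
Qed.

(* Every [r] in [R] with few neighbours in some member of [P] is absorbed into
   it.  The other vertices of [R] see a dense, hence clique-rich, part of every
   member of [P], so [komlos] applies to [R' :: P] and yields the next box.
   Its members may be exponentially small fractions of the old ones; this is
   harmless, as polynomially many greedy steps make the rest of [R'] smaller
   still. *)
Lemma clique_free_stage u P R : size P + u = t ->
  disjoint_box (R :: P) -> all (sparse p) P ->
  all (fun A => p * #|R| <= #|A|) P -> 0 < vol P ->
  (forall Y, sub_box Y P -> dense_box p Y P ->
     vol P <= inv_density t n (size P) * ncliques Y) ->
  sparse_partition n (nparts t n u (size P)) (R :|: union P).
Proof.
elim: u P R => [|u IHu] P R sPu dRP sP RP P0 reg.
  (* With no rounds left [P] has [t] members, so a transversal clique contradicts [Gfree]. *)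
  have := reg P (sub_box_refl P) (dense_box_refl P).
  have [->|/ncliques_gt0_clique[K [cK sK _]]] := posnP (ncliques P).
    by rewrite muln0 leqNgt P0.
  by have := Gfree cK; rewrite sK -sPu addn0 eqxx.
set s := size P; set R' := unabsorbed p P R.
have R'R : R' \subset R by apply/subsetP => x; rewrite inE => /andP[].
have [R0|R0] := posnP #|R'|.
  have := @absorb G n P [seq set0 | _ <- P] R dRP.
  have -> : sub_box [seq set0 | _ <- P] P by elim: (P) => //= A P' ->; rewrite sub0set.
  have -> : all2 (fun B A : {set G} => #|A| <= 3 * #|A :\: B|) [seq set0 | _ <- P] P.
    by elim: (P) => //= A P' ->; rewrite setD0 leq_pmull.
  have -> : union [seq set0 | _ <- P] = set0 :> {set G}.
    by rewrite /union big_map big1.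
  move/(_ isT isT sP RP); rewrite -[unabsorbed _ _ _]/R' (cards0_eq R0) setU0 setD0.
  by apply: sparse_partition_leq; rewrite /= -addnA leq_addr.
have VR : vol (R' :: P) <= inv_density t n s * ncliques (R' :: P).
  rewrite vol_cons ncliques_cons big_distrr /= -sum_nat_const leq_sum // => r rR.
  by apply: reg; [apply: sub_box_setI | apply: dense_box_unabsorbed rR].
have VR0 : 0 < vol (R' :: P) by rewrite vol_cons muln_gt0 R0.
(* The next round tests [p]-dense sub-boxes of [S], itself [Q]-dense in [Z]; so [komlos] is used
   with [q = p * Q]. *)
have q0 : 0 < p * Q by rewrite muln_gt0 sparsity_gt0 shrink_gt0.
have [Z [ZP Z0 ZD Zreg]] := komlos (ltn0Sn _ : 0 < size (R' :: P)) q0 VR0 VR.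
have [S [SZ sS SD S2]] := half_sparse_box Z.
have SP := sub_box_trans SZ ZP.
have szS := sub_box_size SP.
pose M := inv_density t n s ^ komlos_exponent t n s * Q.
have SPD : dense_box M S (R' :: P) := dense_box_trans SD ZD.
have S0 := vol_dense_gt0 SD Z0.
(* The head of [S] lies in [R'] and becomes a member of the next box, so the greedy steps run on the
   rest of [R']. *)
have [R'' [hR'' pR'' cR'']] := greedy_sparse_exp
   (p * Q + inv_density t n s * komlos_exponent t n s) (R' :\: head set0 S).
have C0 : 0 < komlos_exponent t n s by rewrite !muln_gt0 expn_gt0 q0.
(* Uses [x <= 2 ^ x] for [p * Q] and for the inverse density. *)
have R''M : p * M * #|R''| <= #|R'|.
  apply: leq_trans (leq_trans cR'' (subset_leq_card (subsetDl _ _))).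
  rewrite leq_mul2r; apply/orP; right.
  rewrite /M mulnCA mulnC expnD leq_mul ?(ltnW (ltn_expl _ _)) //.
  by rewrite (expnM 2) (leq_exp2r _ _ C0) ltnW // ltn_expl.
have M0 : 0 < M.
  rewrite muln_gt0 shrink_gt0 expn_gt0 andbT; apply/orP; left.
  by move: VR VR0; case: (inv_density _ _ _) => //; rewrite mul0n; case: (vol _).
case: S SZ sS SD S2 SP szS SPD S0 hR'' pR'' cR'' =>
  // S0' S SZ sS SD S2 SP [szS] SPD S0 hR'' pR'' cR''.
rewrite /= in hR'' pR''.
have dR'P : disjoint_box (R' :: P).
  by apply: sub_box_disjoint dRP; rewrite /sub_box /= R'R; apply: sub_box_refl.
have dRUP : [disjoint R & union P] by case/andP: dRP.
have S0R' : S0' \subset R' by case/andP: SP.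
have SP' : sub_box S P by case/andP: SP.
have USP := sub_box_union SP'.
have dR''S : [disjoint R'' & S0' :|: union S].
  rewrite -setI_eq0 setIUr setU_eq0 !setI_eq0; apply/andP; split.
    by apply: disjointWl hR'' _; rewrite -setI_eq0 setIDAC setDIl setDv setI0.
  apply: disjointWr USP _; apply: disjointWl dRUP.
  exact: subset_trans hR'' (subset_trans (subsetDl _ _) R'R).
have IH : sparse_partition n (nparts t n u (size P).+1) (R'' :|: union (S0' :: S)).
  rewrite -szS; apply: (IHu (S0' :: S) R'').
  - by rewrite /= szS addSnnS.
  - by rewrite /= union_cons dR''S; apply: sub_box_disjoint SP dR'P.
  - exact: sS.
  (* Members of [R' :: P] have at least [#|R'|] vertices, so those of [S] have at least
     [#|R'| / M >= p * #|R''|]. *)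
  - have : all (fun A => #|R'| <= #|A|) (R' :: P).
      rewrite /= leqnn; apply: sub_all RP => A; apply: leq_trans.
      by rewrite (leq_trans (subset_leq_card R'R)) // leq_pmull // sparsity_gt0.
    elim: (S0' :: S) (R' :: P) SPD => [|B Y IHY] [|A W] //= /andP[AB YW] /andP[RA RW].
    rewrite (IHY W) // andbT -(leq_pmul2l M0) mulnA [M * p]mulnC.
    exact: leq_trans R''M (leq_trans RA AB).
  - exact: S0.
  - move=> Y YS YD; apply: leq_trans (leq_vol SZ) _.
    have := Zreg Y (sub_box_trans YS SZ).
    rewrite [p * Q]mulnC => /(_ (dense_box_trans YD SD)).
    by rewrite [Q * p]mulnC /= szS.
(* Halving may be off by one vertex; this is harmless since [R] is nonempty and so [#|A| >= 6]. *)
have hS3 : all2 (fun B A : {set G} => #|A| <= 3 * #|A :\: B|) S P.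
  have R1 : 0 < #|R| by apply: leq_trans R0 (subset_leq_card R'R).
  case: Z ZP S2 {Z0 ZD Zreg SZ SD} => // Z1 Z /andP[_ ZP] /andP[_ S2].
  elim: (S) (Z) (P) SP' ZP S2 RP => [|B Y IHY] [|D W] [|A X] //=.
  move=> /andP[BA YX] /andP[DA WX] /andP[BD YW] /andP[RA RX].
  rewrite (IHY W) // andbT.
  have := cardsID B A; rewrite (setIidPr BA); have := subset_leq_card DA.
  have : 5 < #|A|.
    by apply: leq_trans RA; rewrite /sparsity -mulnA leq_pmulr // muln_gt0 n_gt0.
  by move: BD; clear; lia.
have pX := @absorb G n P S R dRP SP' hS3 sP RP; rewrite -[unabsorbed _ _ _]/R' in pX.
(* The absorbed part, the greedy part of [R'], and the input of the next round. *)
have -> : R :|: union P = ((R :|: union P) :\: (R' :|: union S)) :|: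
    (((R' :\: S0') :\: R'') :|: (R'' :|: union (S0' :: S))).
  apply/setP => x; rewrite union_cons.
  have : (x \in R') ==> (x \in R) by apply/implyP/subsetP.
  have : (x \in S0') ==> (x \in R') by apply/implyP/subsetP.
  have : (x \in R'') ==> (x \in R' :\: S0') by apply/implyP/subsetP.
  have : (x \in union S) ==> (x \in union P) by apply/implyP/subsetP.
  rewrite !(in_setU, in_setD).
  by case: (x \in R); case: (x \in R'); case: (x \in R''); case: (x \in S0');
    case: (x \in union S); case: (x \in union P).
have dis x : x \in R' -> x \notin union S.
  by move=> /(subsetP R'R) xR; apply: contraFN (disjointFr dRUP xR) => /(subsetP USP).
rewrite /= -addnA; apply: sparse_partitionU => //; last apply: sparse_partitionU => //.
  rewrite disjoints_subset; apply/subsetP => x; rewrite union_cons.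
  have : (x \in S0') ==> (x \in R') by apply/implyP/subsetP.
  have : (x \in R'') ==> (x \in R' :\: S0') by apply/implyP/subsetP.
  rewrite !(in_setC, in_setU, in_setD).
  by case: (x \in R); case: (x \in R'); case: (x \in R''); case: (x \in S0');
    case: (x \in union S); case: (x \in union P).
rewrite disjoints_subset; apply/subsetP => x; rewrite union_cons.
have : (x \in R') ==> (x \notin union S) by apply/implyP/dis.
rewrite !(in_setC, in_setU, in_setD).
by case: (x \in R'); case: (x \in R''); case: (x \in S0'); case: (x \in union S).
Qed.

(** The iteration starts from the empty box, of volume and clique count 1. *)
Lemma clique_free_partition : sparse_partition n (nparts t n t 0) [set: G].
Proof.
have := @clique_free_stage t [::] [set: G]; rewrite /union big_nil setU0; apply=> //.
- by rewrite /= /union big_nil -setI_eq0 setI0 eqxx.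
- by rewrite /vol big_nil.
- by move=> [|//] _ _; rewrite /vol big_nil.
Qed.

End CliqueFree.

(** * Polynomial growth of the constants *)

Section PolynomialBounds.
Implicit Types f g : nat -> nat.

(** For [n >= 2] constants go into the exponent: [m <= 2 ^ m <= n ^ m]. *)
Definition poly_bounded f := exists c, forall n, 1 < n -> f n <= n ^ c.

Lemma poly_bounded_cst m : poly_bounded (fun=> m).
Proof.
exists m => n n1; apply: leq_trans (ltnW (ltn_expl m (leqnn 2))) _.
by case: m => // m; rewrite leq_exp2r.
Qed.

Lemma poly_bounded_id : poly_bounded id.
Proof. by exists 1. Qed.

Lemma poly_boundedM f g :
  poly_bounded f -> poly_bounded g -> poly_bounded (fun n => f n * g n).
Proof.
by move=> [a fa] [b gb]; exists (a + b) => n n1; rewrite expnD leq_mul ?fa ?gb.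
Qed.

Lemma poly_boundedD f g :
  poly_bounded f -> poly_bounded g -> poly_bounded (fun n => f n + g n).
Proof.
move=> [a fa] [b gb]; exists (a + b).+1 => n n1.
have n0 := ltnW n1.
apply: (@leq_trans (2 * n ^ (a + b))); last by rewrite expnS leq_mul2r n1 orbT.
rewrite mul2n -addnn leq_add //.
  by apply: leq_trans (fa n n1) _; rewrite leq_pexp2l ?leq_addr.
by apply: leq_trans (gb n n1) _; rewrite leq_pexp2l ?leq_addl.
Qed.

Lemma poly_boundedX f m : poly_bounded f -> poly_bounded (fun n => f n ^ m).
Proof.
move=> [a fa]; exists (a * m) => n n1; rewrite expnM.
by case: m => // m; rewrite leq_exp2r ?fa.
Qed.

Lemma poly_bounded_sparsity : poly_bounded sparsity.
Proof. exact: poly_boundedM (poly_bounded_cst 6) poly_bounded_id. Qed.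

Lemma poly_bounded_shrink t : poly_bounded (shrink t).
Proof. exact: poly_boundedM (poly_bounded_cst 2) (poly_boundedX t poly_bounded_sparsity). Qed.

Lemma poly_bounded_nparts t u s : poly_bounded (fun n => nparts t n u s).
Proof.
have pq : poly_bounded (fun n => sparsity n * shrink t n).
  exact: poly_boundedM poly_bounded_sparsity (poly_bounded_shrink t).
have pD : forall s', poly_bounded (fun n => inv_density t n s').
  elim=> [|s' IHs] /=; first exact: poly_bounded_cst.
  apply: poly_boundedM IHs.
  exact: poly_boundedM (poly_bounded_cst 2) (poly_boundedX _ pq).
elim: u s => [|u IHu] s /=; first exact: poly_bounded_cst.
apply: poly_boundedD (IHu s.+1); apply: poly_boundedD; first exact: poly_bounded_cst.
apply: poly_boundedM; first exact: poly_bounded_shrink.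
apply: (poly_boundedD pq); apply: (poly_boundedM (pD s)).
exact: poly_boundedM (poly_bounded_cst _) (poly_boundedX _ pq).
Qed.

End PolynomialBounds.

(** * Translation to induced subgraphs and real [eps] *)

Lemma clique_graph_iso (H G : sgraph) (K : {set G}) : complete_graph H ->
  clique K -> #|K| = #|H| -> graph_iso (induced K) H.
Proof.
move=> hH cK sK.
have eK : #|{: {x : G | x \in K}}| = #|H| by rewrite card_sig -sK; apply: eq_card.
pose f (x : induced K) : H := enum_val (cast_ord eK (enum_rank x)).
have fI : injective f by move=> x y /enum_val_inj/cast_ord_inj/enum_rank_inj.
exists f; first by apply: inj_card_bij => //; rewrite eK.
move=> x y; have [->|xy] := eqVneq x y; first by rewrite !adj_irrefl.
rewrite (hH _ _ (contra_neq (@fI x y) xy)).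
by apply/esym/cK; rewrite ?(valP x) ?(valP y).
Qed.

Lemma graph_free_clique (H G : sgraph) (K : {set G}) :
  complete_graph H -> graph_free H G -> clique K -> #|K| != #|H|.
Proof.
move=> hH GH cK; apply/eqP => sK; apply: GH; exists K.
exact: clique_graph_iso.
Qed.

Lemma max_degree_induced n (G : sgraph) (S : {set G}) :
  sparse n S -> n * max_degree (induced S) <= #|S|.
Proof.
move=> /sparseP sS; rewrite /max_degree.
elim/big_ind: _ => [|x y hx hy|v _]; first by rewrite muln0.
  by rewrite maxnMr geq_max hx.
apply: leq_trans (sS (val v) (valP v)); rewrite leq_mul2l; apply/orP; right.
rewrite /degree -(card_imset _ val_inj); apply: subset_leq_card.
by apply/subsetP => _ /imsetP[w hw ->]; rewrite !inE (valP w) andbT; rewrite inE in hw.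
Qed.

Local Open Scope ring_scope.

Theorem theorem7 (R : realType) (H : sgraph) (hH : complete_graph H) :
  strong_polynomial_Rodl R H.
Proof.
have [c hc] := poly_bounded_nparts #|H| #|H| 0.
(* The 2 comes from [n <= eps^-2]; [c.+1] keeps the exponent positive. *)
exists (2 * c.+1)%:R; first by rewrite ltr0n.
move=> eps eps0 eps2 G GH.
(* As [n] exceeds [1/eps], [n]-sparse sets are [eps]-restricted; [1/eps >= 2] gives
   [n <= 1/eps + 1 <= eps^-2]. *)
set n := (Num.truncn eps^-1).+1.
have inv2 : 2 <= eps^-1 by rewrite -[2]invrK lef_pV2 ?posrE ?invr_gt0 // -div1r.
have /andP[n1 n2] : n.-1%:R <= eps^-1 < n%:R.
  by apply: truncn_itv; rewrite invr_ge0 ltW.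
have n3 : n%:R <= eps^-1 ^+ 2.
  by rewrite -[n]/(n.-1.+1) -natr1; nra.
have n4 : (1 < n)%N by rewrite -(ltr_nat R); lra.
have [|Q [pQ cQ sQ]] := @clique_free_partition G #|H| n isT.
  by move=> K; apply: graph_free_clique.
exists Q; split=> // [|S /sQ/max_degree_induced hS].
  rewrite div1r powR_mulrn ?invr_ge0 ?(ltW eps0) // exprM.
  apply: (@le_trans _ _ (n%:R ^+ c.+1)).
    rewrite -natrX ler_nat; apply: leq_trans cQ (leq_trans (hc n n4) _).
    by rewrite leq_pexp2l.
  by rewrite lerXn2r ?nnegrE // exprn_ge0 // invr_ge0 ltW.
left; rewrite -ler_pdivrMl //; apply: (@le_trans _ _ (n%:R * (max_degree (induced S))%:R)).
  by rewrite ler_wpM2r // ltW.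
by rewrite -natrM ler_nat.
Qed.
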